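(* Let $m,n$ be positive integers, $G=\mathbb{Z}_m\times\mathbb{Z}_n$, let $a\in\{0,\ldots,m-1\}$, $b\in\{0,\ldots,(m,n)-1\}$, $d\in\{0,\ldots,n-1\}$, $\Phi=\Phi_{a,b,d}$, and let $r_{11},r_{12},r_{21},r_{22}\in k^*$. Then there is a quasi-bicharacter $\mathcal{R}$ with respect to $\Phi$ satisfying $\mathcal{R}(g_1,g_1)=r_{11}$, $\mathcal{R}(g_1,g_2)=r_{12}$, $\mathcal{R}(g_2,g_1)=r_{21}$, $\mathcal{R}(g_2,g_2)=r_{22}$ if and only if the following equations are satisfied: $$r_{11}^m=\zeta_m^a=\zeta_m^{-a},\quad r_{22}^n=\zeta_n^d=\zeta_n^{-d},$$ $$r_{12}^n=1,\quad r_{12}^m=\zeta_n^{-b},$$ $$r_{21}^n=1,\quad r_{21}^m=\zeta_n^{b}.$$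
   Context: $k$ is an algebraically closed field of characteristic zero and $k^*=k\setminus\{0\}$. $(m,n)$ denotes the greatest common divisor of $m$ and $n$; $[x]$ denotes the integer part (floor) of a rational number $x$; for each natural number $s$, $\zeta_s\in k$ is a fixed primitive $s$-th root of unity. $g_1$ (resp. $g_2$) is a generator of $\mathbb{Z}_m$ (resp. $\mathbb{Z}_n$), with groups written multiplicatively. $\Phi_{a,b,d}$ is the normalized $3$-cocycle on $G$ with coefficients in $k^*$ (trivial action) given by $$\Phi_{a,b,d}(g_1^ig_2^j,\,g_1^sg_2^t,\,g_1^kg_2^l)=\zeta_m^{a[\frac{k+s}{m}]i}\,\zeta_n^{b[\frac{k+s}{m}]j}\,\zeta_n^{d[\frac{t+l}{n}]j},\qquad 0\le i,s,k<m,\ 0\le j,t,l<n.$$ For a group $G$ and a normalized $3$-cocycle $\Phi$ on $G$ with coefficients in $k^*$, a quasi-bicharacter with respect to $\Phi$ is a map $\mathcal{R}:G\times G\to k^*$ such that for all $x,y,z\in G$ $$\mathcal{R}(xy,z)=\Phi(z,x,y)\,\mathcal{R}(x,z)\,\Phi^{-1}(x,z,y)\,\mathcal{R}(y,z)\,\Phi(x,y,z),$$ $$\mathcal{R}(x,yz)=\Phi^{-1}(y,z,x)\,\mathcal{R}(x,z)\,\Phi(y,x,z)\,\mathcal{R}(x,y)\,\Phi^{-1}(x,y,z),$$ where $\Phi^{-1}(x,y,z)=\Phi(x,y,z)^{-1}$. *)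

(* Defs.v *)
From HB Require Import structures.
From mathcomp Require Import all_boot all_order all_fingroup all_algebra.
From mathcomp Require Import all_solvable.

Set Implicit Arguments.
Unset Strict Implicit.
Unset Printing Implicit Defensive.

Import GroupScope GRing.Theory.
Local Open Scope ring_scope.

(* The exponent 0 <= i < #[g] with g ^+ i = x, when x \in <[g]>. *)
Definition cyc_exp (gT : finGroupType) (g x : gT) : nat :=
  find (fun i => (g ^+ i)%g == x) (iota 0 #[g]%g).

Lemma cyc_expX (gT : finGroupType) (g : gT) (i : nat) :
  (i < #[g]%g)%N -> cyc_exp g (g ^+ i)%g = i.
Proof.
move=> lt_i; rewrite /cyc_exp.
rewrite -(@eq_in_find _ (pred1 i)); last first.
  move=> j; rewrite mem_iota add0n => /= lt_j.
  by rewrite eq_expg_mod_order !modn_small.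
have /= := @index_uniq _ 0%N i (iota 0 #[g]%g).
by rewrite size_iota nth_iota // add0n iota_uniq; exact.
Qed.

Section Phi.
Variables (k : fieldType) (zeta : nat -> k) (m n : nat).
Variables (gT1 gT2 : finGroupType) (g1 : gT1) (g2 : gT2).

(* Meant for generators g1, g2 of cyclic groups of orders m, n; PhiE gives the
   values on g1 ^+ i * g2 ^+ j. *)
Definition Phi (a b d : nat) (x y z : gT1 * gT2) : k :=
  let i := cyc_exp g1 x.1 in let j := cyc_exp g2 x.2 in
  let s := cyc_exp g1 y.1 in let t := cyc_exp g2 y.2 in
  let p := cyc_exp g1 z.1 in let l := cyc_exp g2 z.2 in
  zeta m ^+ (a * ((p + s) %/ m) * i)%N
  * zeta n ^+ (b * ((p + s) %/ m) * j)%N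
  * zeta n ^+ (d * ((t + l) %/ n) * j)%N.

Lemma PhiE (a b d i j s t p l : nat) :
  #[g1]%g = m -> #[g2]%g = n ->
  (i < m)%N -> (s < m)%N -> (p < m)%N -> (j < n)%N -> (t < n)%N -> (l < n)%N ->
  let h1 : gT1 * gT2 := (g1, 1%g) in let h2 : gT1 * gT2 := (1%g, g2) in
  Phi a b d (h1 ^+ i * h2 ^+ j)%g (h1 ^+ s * h2 ^+ t)%g (h1 ^+ p * h2 ^+ l)%g
  = zeta m ^+ (a * ((p + s) %/ m) * i)%N
    * zeta n ^+ (b * ((p + s) %/ m) * j)%N
    * zeta n ^+ (d * ((t + l) %/ n) * j)%N.
Proof.
move=> o1 o2 hi hs hp hj ht hl h1 h2.
have E u v : (h1 ^+ u * h2 ^+ v)%g = (g1 ^+ u, g2 ^+ v)%g.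
  have E1 w : (h1 ^+ w)%g = (g1 ^+ w, 1)%g.
    by elim: w => [//|w IH]; rewrite !expgS IH; congr pair; rewrite /= mulg1.
  have E2 w : (h2 ^+ w)%g = (1, g2 ^+ w)%g.
    by elim: w => [//|w IH]; rewrite !expgS IH; congr pair; rewrite /= mulg1.
  by rewrite E1 E2; congr pair; rewrite /= ?mulg1 ?mul1g.
by rewrite !E /Phi /= !cyc_expX ?o1 ?o2.
Qed.

End Phi.

(* A map R : G x G -> k^* is encoded as a nowhere zero map to k. *)
Definition quasi_bicharacter (k : fieldType) (gT : groupType)
    (Phi : gT -> gT -> gT -> k) (R : gT -> gT -> k) : Prop :=
  [/\ forall x y, R x y != 0,
      forall x y z, R (x * y)%g z =
        Phi z x y * R x z * (Phi x z y)^-1 * R y z * Phi x y z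
    & forall x y z, R x (y * z)%g =
        (Phi y z x)^-1 * R x z * Phi y x z * R x y * (Phi x y z)^-1].

(* Main.v *)
Require Import Defs.
From HB Require Import structures.
From mathcomp Require Import all_boot all_order all_fingroup all_algebra.
From mathcomp Require Import all_solvable.

Set Implicit Arguments.
Unset Strict Implicit.
Unset Printing Implicit Defensive.

Import GroupScope GRing.Theory.
Local Open Scope ring_scope.

(* Since Phi(x, y, z) is symmetric in y and z, the two axioms say that
   R(xy, z) = Phi(z, x, y) R(x, z) R(y, z) and
   R(x, yz) = Phi(x, y, z)^-1 R(x, y) R(x, z).
   Writing Phi(x, y, z) = u(x)^c1(y, z) v(x)^c2(y, z) with c1, c2 the carries of
   the additions mod m and mod n, R is in each variable a homomorphism twisted
   by carries.  On a cyclic group <[g]>, a map f twisted by w^carry satisfies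
   f(g^i) = f(g)^i for i < #[g], and wrapping around forces w f(g)^#[g] = 1;
   conversely that equation makes g^i |-> r^i a twisted homomorphism. *)

(** * Carries in a cyclic group and maps twisted by them *)

Section Carry.
Variables (gT : finGroupType) (g : gT).

(** On [<[g]>] this is 0 or 1: the 2-cocycle of the extension of the cyclic group by the
    integers. *)
Definition carry (x y : gT) : nat :=
  ((cyc_exp g x + cyc_exp g y) %/ #[g]%g)%N.

Lemma carryC x y : carry x y = carry y x.
Proof. by rewrite /carry addnC. Qed.

Lemma cyc_expXmod i : cyc_exp g (g ^+ i)%g = (i %% #[g]%g)%N.
Proof. by rewrite -(expg_mod_order g i) cyc_expX // ltn_mod order_gt0. Qed.

Lemma cyc_exp1 : cyc_exp g 1%g = 0%N.
Proof. by rewrite -(expg0 g) cyc_expXmod mod0n. Qed.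

Lemma cyc_exp_gen : cyc_exp g g = (1 %% #[g]%g)%N.
Proof. by rewrite -{2}(expg1 g) cyc_expXmod. Qed.

(** When [g] has order 1 its exponent is 0 instead of 1, whence the side condition. *)
Lemma expr_cyc_exp_gen (R : nzRingType) (r : R) :
  (#[g]%g = 1%N -> r = 1) -> r ^+ cyc_exp g g = r.
Proof.
move=> r1; have [og|og] := eqVneq #[g]%g 1%N; first by rewrite r1 ?expr1n.
by rewrite cyc_exp_gen modn_small ?expr1 // ltn_neqAle eq_sym og order_gt0.
Qed.

Lemma carry11 : carry 1%g 1%g = 0%N.
Proof. by rewrite /carry cyc_exp1 div0n. Qed.

Lemma cyc_expM x y : x \in <[g]>%g -> y \in <[g]>%g ->
  (cyc_exp g x + cyc_exp g y = carry x y * #[g]%g + cyc_exp g (x * y)%g)%N.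
Proof.
move=> /cyclePmin[i lt_i ->] /cyclePmin[j lt_j ->].
by rewrite /carry -expgD (cyc_expXmod (i + j)) !cyc_expX // -divn_eq.
Qed.

Variables (k : fieldType) (w : k).

Lemma carry_hom_order (f : gT -> k) :
  f 1%g != 0 -> (#[g]%g = 1%N -> w = 1) ->
  {in <[g]>%g &, forall x y, f (x * y)%g = w ^+ carry x y * f x * f y} ->
  w * f g ^+ #[g]%g = 1.
Proof.
move=> f1_neq0 w1 fM.
(* The twisted law at the identity has no carry, so [f 1] is a nonzero idempotent. *)
have f1 : f 1%g = 1.
  have := fM 1%g 1%g (group1 _) (group1 _).
  rewrite mulg1 carry11 expr0 mul1r -[LHS]mul1r.
  by move/(mulIf f1_neq0).
(* In order 1 no carry ever occurs, so the law says nothing about [w]; the hypothesis on [w] takes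
   over. *)
have [og|og] := eqVneq #[g]%g 1%N.
  have /eqP g1 : g == 1%g by rewrite -order_eq1 og.
  by rewrite w1 // og g1 f1 expr1n mulr1.
have g_gt1 : (1 < #[g]%g)%N by rewrite ltn_neqAle eq_sym og order_gt0.
have fX i : (i < #[g]%g)%N -> f (g ^+ i)%g = f g ^+ i.
  elim: i => [|i IHi] lt_i; first by rewrite expg0 f1.
  rewrite expgSr fM ?mem_cycle ?cycle_id // IHi ?(ltnW lt_i) //.
  rewrite /carry cyc_expX ?(ltnW lt_i) // cyc_exp_gen modn_small // addn1.
  by rewrite divn_small // expr0 mul1r exprSr.
(* The last product, of [g ^+ #[g].-1] and [g], has carry 1 and closes the cycle. *)
have lt_p : (#[g]%g.-1 < #[g]%g)%N by rewrite prednK.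
have := fM (g ^+ #[g].-1)%g g (mem_cycle _ _) (cycle_id _).
rewrite -expgSr prednK // expg_order f1 fX //.
rewrite /carry cyc_expX // cyc_exp_gen modn_small // addn1 prednK // divnn.
by rewrite order_gt0 expr1 -mulrA -exprSr prednK.
Qed.

(** Each carry removes [r ^+ #[g]] from the product of the two powers, and [w] compensates for
    exactly this factor. *)
Lemma carry_hom_expr (r : k) x y : w * r ^+ #[g]%g = 1 ->
  x \in <[g]>%g -> y \in <[g]>%g ->
  r ^+ cyc_exp g (x * y)%g
    = w ^+ carry x y * r ^+ cyc_exp g x * r ^+ cyc_exp g y.
Proof.
move=> wr xg yg; rewrite -mulrA -exprD cyc_expM // exprD mulnC exprM mulrA.
by rewrite -exprMn wr expr1n mul1r.
Qed.

End Carry.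

Lemma generatorT_mem (gT : finGroupType) (g x : gT) :
  generator [set: gT] g -> x \in <[g]>%g.
Proof. by move=> /eqP <-; rewrite inE. Qed.

Lemma generatorT_order (gT : finGroupType) (g : gT) :
  generator [set: gT] g -> #[g]%g = #|[set: gT]|.
Proof. by rewrite orderE => /eqP <-. Qed.

(** By symmetry, [F x y z] cancels the inverse of [F x z y] in the first axiom, and [F y x z] that
    of [F y z x] in the second. *)
Lemma sym_quasi_bicharacterE (k : fieldType) (gT : groupType)
    (F : gT -> gT -> gT -> k) (R : gT -> gT -> k) :
  (forall x y z, F x y z != 0) -> (forall x y z, F x y z = F x z y) ->
  quasi_bicharacter F R <->
  [/\ forall x y, R x y != 0,
      forall x y z, R (x * y)%g z = F z x y * R x z * R y z
    & forall x y z, R x (y * z)%g = (F x y z)^-1 * R x y * R x z].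
Proof.
move=> F0 FC; split=> -[R0 RMl RMr]; split=> // x y z; rewrite (RMl, RMr).
- by rewrite (FC x z y) -!mulrA; congr (_ * (_ * _)); rewrite mulrCA mulVf ?mulr1.
- by rewrite (FC y z x) [_^-1 * _ * _]mulrAC mulVf // mul1r mulrC mulrAC mulrA.
- by rewrite (FC x z y) -!mulrA; congr (_ * (_ * _)); rewrite mulrCA mulVf ?mulr1.
- by rewrite (FC y z x) [_^-1 * R x z * _]mulrAC mulVf // mul1r mulrC mulrAC mulrA.
Qed.

(** * The cocycle [Phi] as a product of powers with carries as exponents *)

Section PhiTwist.
Variables (k : fieldType) (zeta : nat -> k).
Variables (gT1 gT2 : finGroupType) (g1 : gT1) (g2 : gT2).
Variables a b d : nat.
Local Notation m := #[g1]%g.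
Local Notation n := #[g2]%g.
Local Notation F := (Phi zeta m n g1 g2 a b d).

(** The u of the opening formula. The [a] and [b] terms share it, since both carry in the first
    coordinate; [twist2] is v. *)
Definition twist1 (x : gT1 * gT2) : k :=
  zeta m ^+ a ^+ cyc_exp g1 x.1 * zeta n ^+ b ^+ cyc_exp g2 x.2.

Definition twist2 (x : gT1 * gT2) : k := zeta n ^+ d ^+ cyc_exp g2 x.2.

Lemma Phi_twist x y z :
  F x y z = twist1 x ^+ carry g1 y.1 z.1 * twist2 x ^+ carry g2 y.2 z.2.
Proof.
rewrite /Phi /twist1 /twist2 (carryC g1) exprMn -!exprM.
by rewrite -!mulnA ![(carry _ _ _ * _)%N]mulnC !mulnA ![(_ * carry _ _ _)%N]mulnAC.
Qed.

Lemma PhiC x y z : F x y z = F x z y.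
Proof. by rewrite !Phi_twist carryC [carry g2 _ _]carryC. Qed.

Hypothesis zetaP : forall s : nat, (0 < s)%N -> s.-primitive_root (zeta s).

Lemma zeta_neq0 s : (0 < s)%N -> zeta s != 0.
Proof. by move=> s_gt0; rewrite (prim_root_eq0 (zetaP s_gt0)) -lt0n. Qed.

Lemma Phi_neq0 x y z : F x y z != 0.
Proof. by rewrite !mulf_neq0 ?expf_neq0 ?zeta_neq0 ?order_gt0. Qed.

Let h1 : gT1 * gT2 := (g1, 1%g).
Let h2 : gT1 * gT2 := (1%g, g2).

Lemma zeta1 : zeta 1%N = 1.
Proof. by rewrite -[LHS]expr1 (prim_expr_order (zetaP _)). Qed.

Lemma zeta_cyc_exp_gen (gT : finGroupType) (g : gT) c :
  zeta #[g]%g ^+ c ^+ cyc_exp g g = zeta #[g]%g ^+ c.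
Proof. by apply: expr_cyc_exp_gen => ->; rewrite zeta1 expr1n. Qed.

Lemma twist1_h1 : twist1 h1 = zeta m ^+ a.
Proof. by rewrite /twist1 /= zeta_cyc_exp_gen cyc_exp1 mulr1. Qed.

Lemma twist1_h2 : twist1 h2 = zeta n ^+ b.
Proof. by rewrite /twist1 /= zeta_cyc_exp_gen cyc_exp1 mul1r. Qed.

Lemma twist2_h1 : twist2 h1 = 1.
Proof. by rewrite /twist2 cyc_exp1. Qed.

Lemma twist2_h2 : twist2 h2 = zeta n ^+ d.
Proof. by rewrite /twist2 /= zeta_cyc_exp_gen. Qed.

(** The bound on [b] matters here: it forces [b] to vanish for [m] equal to 1, although [zeta n] may
    be nontrivial. *)
Lemma twist1_trivial x : (b < gcdn m n)%N -> m = 1%N -> twist1 x = 1.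
Proof.
move=> b_lt m1; move: b_lt; rewrite /twist1 m1 gcd1n ltnS leqn0 => /eqP->.
by rewrite zeta1 expr0 !expr1n mulr1.
Qed.

Lemma twist2_trivial x : n = 1%N -> twist2 x = 1.
Proof. by move=> n1; rewrite /twist2 n1 zeta1 !expr1n. Qed.

(** * Order conditions forced on a quasi-bicharacter *)

Section Orders.
Variable R : gT1 * gT2 -> gT1 * gT2 -> k.
Hypothesis b_lt : (b < gcdn m n)%N.
Hypothesis R_qb : quasi_bicharacter F R.

(** With one variable fixed at [x], the other runs through a cyclic factor, where only that factor's
    carry survives. The second variable gives inverse twists. *)
Lemma quasi_bicharacter_orders x :
  [/\ twist1 x * R h1 x ^+ m = 1, twist2 x * R h2 x ^+ n = 1,
      (twist1 x)^-1 * R x h1 ^+ m = 1 & (twist2 x)^-1 * R x h2 ^+ n = 1].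
Proof.
have [R0 RMl RMr] :=
  (sym_quasi_bicharacterE R Phi_neq0 PhiC).1 R_qb.
split.
- apply: (@carry_hom_order _ g1 _ _ (fun y => R (y, 1%g) x)) => //.
    exact: twist1_trivial.
  (* Splitting the second coordinate as a product of identities exhibits the pair as a product in
     the direct product. *)
  move=> y z _ _; rewrite -{1}[1%g]mulg1 (RMl (y, 1%g) (z, 1%g)) Phi_twist /=.
  by rewrite carry11 mulr1.
- apply: (@carry_hom_order _ g2 _ _ (fun y => R (1%g, y) x)) => //.
    exact: twist2_trivial.
  move=> y z _ _; rewrite -{1}[1%g]mulg1 (RMl (1%g, y) (1%g, z)) Phi_twist /=.
  by rewrite carry11 mul1r.
- apply: (@carry_hom_order _ g1 _ _ (fun y => R x (y, 1%g))) => //.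
    by move=> m1; rewrite twist1_trivial ?invr1.
  move=> y z _ _; rewrite -{1}[1%g]mulg1 (RMr x (y, 1%g) (z, 1%g)) Phi_twist /=.
  by rewrite carry11 mulr1 exprVn.
- apply: (@carry_hom_order _ g2 _ _ (fun y => R x (1%g, y))) => //.
    by move=> n1; rewrite twist2_trivial ?invr1.
  move=> y z _ _; rewrite -{1}[1%g]mulg1 (RMr x (1%g, y) (1%g, z)) Phi_twist /=.
  by rewrite carry11 mul1r exprVn.
Qed.

End Orders.

(** * A quasi-bicharacter with prescribed values at the generators *)

Section Construction.
Variables r11 r12 r21 r22 : k.

Definition bimonomial (x y : gT1 * gT2) : k :=
  (r11 ^+ cyc_exp g1 y.1 * r12 ^+ cyc_exp g2 y.2) ^+ cyc_exp g1 x.1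
  * (r21 ^+ cyc_exp g1 y.1 * r22 ^+ cyc_exp g2 y.2) ^+ cyc_exp g2 x.2.

(** Grouping by the exponents of [y] makes the twisted law in the second variable visible, as the
    definition does for the first. *)
Lemma bimonomialE x y : bimonomial x y =
  (r11 ^+ cyc_exp g1 x.1 * r21 ^+ cyc_exp g2 x.2) ^+ cyc_exp g1 y.1
  * (r12 ^+ cyc_exp g1 x.1 * r22 ^+ cyc_exp g2 x.2) ^+ cyc_exp g2 y.2.
Proof.
rewrite /bimonomial !exprMn !(exprAC _ (cyc_exp _ x.1)).
by rewrite !(exprAC _ (cyc_exp _ x.2)) mulrACA.
Qed.

Hypotheses (gen1 : generator [set: gT1] g1) (gen2 : generator [set: gT2] g2).
Hypotheses (r11_neq0 : r11 != 0) (r12_neq0 : r12 != 0).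
Hypotheses (r21_neq0 : r21 != 0) (r22_neq0 : r22 != 0).
(** The first four equations are the wrap-around conditions in the first variable, the next four
    those in the second. *)
Hypotheses (r11m : zeta m ^+ a * r11 ^+ m = 1) (r12m : zeta n ^+ b * r12 ^+ m = 1).
Hypotheses (r21n : r21 ^+ n = 1) (r22n : zeta n ^+ d * r22 ^+ n = 1).
Hypotheses (r11m' : r11 ^+ m = zeta m ^+ a) (r21m : r21 ^+ m = zeta n ^+ b).
Hypotheses (r12n : r12 ^+ n = 1) (r22n' : r22 ^+ n = zeta n ^+ d).

Lemma bimonomial_quasi_bicharacter : quasi_bicharacter F bimonomial.
Proof.
apply/(sym_quasi_bicharacterE _ Phi_neq0 PhiC); split=> [x y|x y z|x y z].
- by rewrite mulf_neq0 ?expf_neq0 ?mulf_neq0 ?expf_neq0.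
- rewrite /bimonomial Phi_twist /=.
  (* The wrap-around condition for general [z] is a product of powers of the conditions at the two
     generators. *)
  rewrite (carry_hom_expr (w := twist1 z)) ?generatorT_mem //; last first.
    rewrite exprMn mulrACA !(exprAC _ _ m) -!exprMn r11m r12m.
    by rewrite !expr1n mulr1.
  rewrite (carry_hom_expr (w := twist2 z)) ?generatorT_mem //; last first.
    rewrite exprMn !(exprAC _ _ n) r21n expr1n mul1r -exprMn r22n.
    by rewrite expr1n.
  by rewrite mulrACA [X in X * _]mulrACA.
- rewrite !bimonomialE Phi_twist /= invfM.
  rewrite -(exprVn (twist1 x)) -(exprVn (twist2 x)).
  rewrite (carry_hom_expr (w := (twist1 x)^-1)) ?generatorT_mem //; last first.
    rewrite exprMn !(exprAC _ _ m) r11m' r21m mulVf //.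
    by rewrite mulf_neq0 ?expf_neq0 ?zeta_neq0 ?order_gt0.
  rewrite (carry_hom_expr (w := (twist2 x)^-1)) ?generatorT_mem //; last first.
    rewrite exprMn !(exprAC _ _ n) r12n r22n' expr1n mul1r mulVf //.
    by rewrite !expf_neq0 ?zeta_neq0 ?order_gt0.
  by rewrite mulrACA [X in X * _]mulrACA.
Qed.

End Construction.

End PhiTwist.


Theorem proposition3p11 (k : closedFieldType) (char0 : [pchar k] =i pred0)
    (zeta : nat -> k)
    (zetaP : forall s : nat, (0 < s)%N -> s.-primitive_root (zeta s))
    (m n : nat) (m_gt0 : (0 < m)%N) (n_gt0 : (0 < n)%N)
    (gT1 gT2 : finGroupType) (g1 : gT1) (g2 : gT2)
    (gen1 : generator [set: gT1] g1) (card1 : #|[set: gT1]| = m)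
    (gen2 : generator [set: gT2] g2) (card2 : #|[set: gT2]| = n)
    (a b d : nat) (lt_a : (a < m)%N) (lt_b : (b < gcdn m n)%N) (lt_d : (d < n)%N)
    (r11 r12 r21 r22 : k)
    (r11_neq0 : r11 != 0) (r12_neq0 : r12 != 0)
    (r21_neq0 : r21 != 0) (r22_neq0 : r22 != 0) :
  let h1 : gT1 * gT2 := (g1, 1%g) in
  let h2 : gT1 * gT2 := (1%g, g2) in
  (exists R : gT1 * gT2 -> gT1 * gT2 -> k,
     quasi_bicharacter (Phi zeta m n g1 g2 a b d) R /\
     [/\ R h1 h1 = r11, R h1 h2 = r12, R h2 h1 = r21 & R h2 h2 = r22])
  <->
  [/\ r11 ^+ m = zeta m ^+ a /\ zeta m ^+ a = zeta m ^- a,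
      r22 ^+ n = zeta n ^+ d /\ zeta n ^+ d = zeta n ^- d,
      r12 ^+ n = 1 /\ r12 ^+ m = zeta n ^- b
    & r21 ^+ n = 1 /\ r21 ^+ m = zeta n ^+ b].
Proof.
move=> h1 h2.
move: card1 card2; rewrite -(generatorT_order gen1) -(generatorT_order gen2).
move=> om on; subst m n.
have z1 c : zeta #[g1]%g ^+ c != 0 by rewrite expf_neq0 ?zeta_neq0.
have z2 c : zeta #[g2]%g ^+ c != 0 by rewrite expf_neq0 ?zeta_neq0.
have eqV (u v : k) : u != 0 -> u * v = 1 -> v = u^-1.
  by move=> u0 uv; rewrite -[LHS](mulKf u0) uv mulr1.
split.
  case=> R [/(quasi_bicharacter_orders zetaP lt_b) orders [R11 R12 R21 R22]].
  (* The names in e come from the first variable, those in f from the second. Their opposite signs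
     on the diagonal yield [zeta ^+ a = zeta ^- a], and likewise for [d]. *)
  have [] := orders h2; have [] := orders h1.
  rewrite twist1_h1 // twist1_h2 // twist2_h1 twist2_h2 //.
  rewrite -/h1 -/h2 R11 R12 R21 R22 invr1 !mul1r.
  move=> e11 e21 f11 f12 e12 e22 f21 f22.
  have r11V := eqV _ _ (z1 a) e11; have r22V := eqV _ _ (z2 d) e22.
  have r11E : r11 ^+ #[g1]%g = zeta #[g1]%g ^+ a.
    by rewrite -[RHS]invrK; apply: eqV f11; rewrite invr_neq0.
  have r22E : r22 ^+ #[g2]%g = zeta #[g2]%g ^+ d.
    by rewrite -[RHS]invrK; apply: eqV f22; rewrite invr_neq0.
  split; split=> //.
  - by rewrite -{1}r11E r11V.
  - by rewrite -{1}r22E r22V.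
  - exact: eqV e12.
  - by rewrite -[RHS]invrK; apply: eqV f21; rewrite invr_neq0.
case=> [[r11m zaV] [r22n zdV] [r12n r12m] [r21n r21m]].
exists (bimonomial g1 g2 r11 r12 r21 r22); split.
  apply: bimonomial_quasi_bicharacter => //.
  - by rewrite r11m {1}zaV mulVf.
  - by rewrite r12m mulfV.
  - by rewrite r22n {1}zdV mulVf.
(* It remains to evaluate at the generators. A generator of order 1 has exponent 0, so the values
   involving it must be shown to be 1. *)
have b_eq0 : #[g1]%g = 1%N -> b = 0%N.
  by move=> m1; move: lt_b; rewrite m1 gcd1n ltnS leqn0 => /eqP.
have r11_1 : #[g1]%g = 1%N -> r11 = 1.
  by move=> m1; rewrite -[r11]expr1 -m1 r11m m1 (zeta1 zetaP) expr1n.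
have r12_1 : #[g1]%g = 1%N -> r12 = 1.
  by move=> m1; rewrite -[r12]expr1 -m1 r12m b_eq0 // expr0 invr1.
have r21_1 : #[g1]%g = 1%N -> r21 = 1.
  by move=> m1; rewrite -[r21]expr1 -m1 r21m b_eq0 // expr0.
have r12_1' : #[g2]%g = 1%N -> r12 = 1 by move=> n1; rewrite -[r12]expr1 -n1.
have r21_1' : #[g2]%g = 1%N -> r21 = 1 by move=> n1; rewrite -[r21]expr1 -n1.
have r22_1 : #[g2]%g = 1%N -> r22 = 1.
  by move=> n1; rewrite -[r22]expr1 -n1 r22n n1 (zeta1 zetaP) expr1n.
by rewrite /bimonomial /= !cyc_exp1 !expr0 !mulr1 !mul1r; split;
  rewrite !expr_cyc_exp_gen.
Qed.
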